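(* Let $\mathbb{F}$ be a field and let $(T,\leq)$ be a dense totally ordered set such that every interval in $T$ has a countable coinitial subset. Let $M$ be a persistence module over $\mathbb{F}$ indexed by $T$ that is q-tame and lower semi-continuous. Then $M$ has a barcode, i.e., there exist an index set $A$ and a collection of intervals $(I_{\alpha})_{\alpha\in A}$ in $T$ such that $M\cong\bigoplus_{\alpha\in A}C(I_{\alpha})$.
   Context: A totally ordered set $T$ is regarded as a category with a unique morphism $s\to t$ whenever $s\leq t$. A persistence module indexed by $T$ is a functor $M$ from $T$ to the category of $\mathbb{F}$-vector spaces, with values $M_t$ and structure maps $M_{s,t}\colon M_s\to M_t$ for $s\leq t$. Morphisms are natural transformations; kernels, cokernels, direct sums and products are computed pointwise. $M$ is q-tame if $M_{s,t}$ has finite rank for all $s<t$ in $T$. $M$ is lower semi-continuous if the canonical map $\operatorname{colim}_{s<t}M_s\to M_t$ is an isomorphism for all $t\in T$ (colimits over empty index sets are $0$). An interval in $T$ is a non-empty subset $I\subseteq T$ such that $s\leq u\leq t$ with $s,t\in I$ and $u\in T$ implies $u\in I$. The interval module $C(I)$ has $C(I)_t=\mathbb{F}$ if $t\in I$ and $C(I)_t=0$ otherwise, with structure map $C(I)_{s,t}=\mathrm{id}_{\mathbb{F}}$ if $s,t\in I$ and $0$ otherwise. $T$ is dense if for all $s<t$ in $T$ there is $u\in T$ with $s<u<t$. For $N\subseteq I\subseteq T$, the subset $N$ is coinitial in $I$ if for all $t\in I$ there is $s\in N$ with $s\leq t$. *)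

(* Defs.v *)
From HB Require Import structures.
From mathcomp Require Import all_boot all_order all_algebra ring_quotient.
From mathcomp Require Import boolp classical_sets functions cardinality fsbigop.

Set Implicit Arguments.
Unset Strict Implicit.
Unset Printing Implicit Defensive.

Import Order.TTheory GRing.Theory.
Local Open Scope classical_set_scope.
Local Open Scope ring_scope.
Local Open Scope quotient_scope.

Record dsum (F : fieldType) (A : Type) (V : A -> lmodType F) := DSum {
  dsum_val :> forall a, V a;
  dsum_fin : finite_set [set a | dsum_val a != 0] }.

Section DirectSum.
Context {F : fieldType} {A : Type} (V : A -> lmodType F).
Implicit Types x y z : dsum V.

Lemma dsumP x y : (forall a, x a = y a) -> x = y.
Proof.
case: x y => [x hx] [y hy] /= exy.
have {exy} exy : x = y by exact: functional_extensionality_dep.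
by case: _ / exy hy => hy; congr DSum; exact: Prop_irrelevance.
Qed.

HB.instance Definition _ := gen_eqMixin (dsum V).
HB.instance Definition _ := gen_choiceMixin (dsum V).

Fact dsum_zero_fin : finite_set [set a | (0 : V a) != 0].
Proof. by apply: (@sub_finite_set _ _ set0) => // a /=; rewrite eqxx. Qed.
Definition dsum_zero : dsum V := DSum dsum_zero_fin.

Fact dsum_opp_fin x : finite_set [set a | - x a != 0].
Proof. by apply: sub_finite_set (dsum_fin x) => a /=; rewrite oppr_eq0. Qed.
Definition dsum_opp x : dsum V := DSum (dsum_opp_fin x).

Fact dsum_add_fin x y : finite_set [set a | x a + y a != 0].
Proof.
have : finite_set ([set a | x a != 0] `|` [set a | y a != 0]).
  by rewrite finite_setU; split; exact: dsum_fin.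
apply: sub_finite_set => a /= xy; apply: contrapT => /not_orP[].
by move=> /negP/negPn/eqP x0 /negP/negPn/eqP y0; rewrite x0 y0 addr0 eqxx in xy.
Qed.
Definition dsum_add x y : dsum V := DSum (dsum_add_fin x y).

Fact dsum_scale_fin k x : finite_set [set a | k *: x a != 0].
Proof.
apply: sub_finite_set (dsum_fin x) => a /=.
by apply: contra_neq => ->; rewrite scaler0.
Qed.
Definition dsum_scale k x : dsum V := DSum (dsum_scale_fin k x).

Fact dsum_addA : associative dsum_add.
Proof. by move=> x y z; apply: dsumP => a; exact: addrA. Qed.
Fact dsum_addC : commutative dsum_add.
Proof. by move=> x y; apply: dsumP => a; exact: addrC. Qed.
Fact dsum_add0 : left_id dsum_zero dsum_add.
Proof. by move=> x; apply: dsumP => a; exact: add0r. Qed.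
Fact dsum_addN : left_inverse dsum_zero dsum_opp dsum_add.
Proof. by move=> x; apply: dsumP => a; exact: addNr. Qed.
HB.instance Definition _ :=
  GRing.isZmodule.Build (dsum V) dsum_addA dsum_addC dsum_add0 dsum_addN.

Fact dsum_scaleA k l x : dsum_scale k (dsum_scale l x) = dsum_scale (k * l) x.
Proof. by apply: dsumP => a; exact: scalerA. Qed.
Fact dsum_scale1 : left_id 1 dsum_scale.
Proof. by move=> x; apply: dsumP => a; exact: scale1r. Qed.
Fact dsum_scaleDr : right_distributive dsum_scale +%R.
Proof. by move=> k x y; apply: dsumP => a; exact: scalerDr. Qed.
Fact dsum_scaleDl x : {morph dsum_scale^~ x : k l / k + l}.
Proof. by move=> k l; apply: dsumP => a; exact: scalerDl. Qed.
HB.instance Definition _ := GRing.Zmodule_isLmodule.Build F (dsum V)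
  dsum_scaleA dsum_scale1 dsum_scaleDr dsum_scaleDl.

Lemma dsum0E a : (0 : dsum V) a = 0. Proof. by []. Qed.
Lemma dsumDE x y a : (x + y) a = x a + y a. Proof. by []. Qed.
Lemma dsumNE x a : (- x) a = - x a. Proof. by []. Qed.
Lemma dsumZE k x a : (k *: x) a = k *: x a. Proof. by []. Qed.

End DirectSum.

Section DirectSumMap.
Context {F : fieldType} {A : Type} (V W : A -> lmodType F).
Variable f : forall a, {linear V a -> W a}.

Fact dsum_map_fin (x : dsum V) : finite_set [set a | f a (x a) != 0].
Proof.
apply: sub_finite_set (dsum_fin x) => a /=.
by apply: contra_neq => ->; rewrite linear0.
Qed.
Definition dsum_map (x : dsum V) : dsum W := DSum (dsum_map_fin x).

Fact dsum_map_linear : linear dsum_map.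
Proof. by move=> k x y; apply: dsumP => a; exact: linearP. Qed.
HB.instance Definition _ :=
  GRing.isLinear.Build F (dsum V) (dsum W) *:%R dsum_map dsum_map_linear.

End DirectSumMap.

Section DirectSumInOut.
Context {F : fieldType} {A : choiceType} (V : A -> lmodType F).

Fact dsum_in_fin a (v : V a) :
  finite_set [set b | dfwith (fun c => 0 : V c) v b != 0].
Proof.
apply: (@sub_finite_set _ _ [set a]) => // b /= h.
by apply: contrapT => /eqP; rewrite eq_sym => ab; rewrite dfwith_out ?eqxx in h.
Qed.
Definition dsum_in a (v : V a) : dsum V := DSum (dsum_in_fin v).

Fact dsum_in_linear a : linear (@dsum_in a).
Proof.
move=> k u v; apply: dsumP => b; rewrite dsumDE dsumZE /=.
have [<-|ab] := eqVneq a b; first by rewrite !dfwith_in.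
by rewrite !dfwith_out // scaler0 addr0.
Qed.
HB.instance Definition _ a :=
  GRing.isLinear.Build F (V a) (dsum V) *:%R (@dsum_in a) (@dsum_in_linear a).

Context {W : lmodType F} (f : forall a, {linear V a -> W}).

(* A finitely supported sum; fsbigop restricts it to the support. *)
Definition dsum_out (x : dsum V) : W := \sum_(a \in [set: A]) f a (x a).

Fact dsum_outE (x : dsum V) (B : set A) : finite_set B ->
  [set a | x a != 0] `<=` B -> dsum_out x = \sum_(a \in B) f a (x a).
Proof.
move=> finB xB; rewrite /dsum_out; apply/esym/fsbig_widen => // a [_ /= nBa].
have [->|/xB//] := eqVneq (x a) 0; exact: linear0.
Qed.

Fact dsum_out_linear : linear dsum_out.
Proof.
move=> k x y.
pose B := [set a | x a != 0] `|` [set a | y a != 0].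
have finB : finite_set B by rewrite finite_setU; split; exact: dsum_fin.
have xB : [set a | x a != 0] `<=` B by move=> a; left.
have yB : [set a | y a != 0] `<=` B by move=> a; right.
have xyB : [set a | (k *: x + y) a != 0] `<=` B.
  move=> a h; apply: contrapT => /not_orP[].
  move=> /negP/negPn/eqP x0 /negP/negPn/eqP y0.
  by move: h; rewrite /mkset dsumDE dsumZE x0 y0 scaler0 addr0 eqxx.
rewrite (dsum_outE finB xB) (dsum_outE finB yB) (dsum_outE finB xyB).
rewrite !fsbig_finite // scaler_sumr -big_split.
by apply: eq_bigr => a _; rewrite dsumDE dsumZE linearP.
Qed.
HB.instance Definition _ :=
  GRing.isLinear.Build F (dsum V) W *:%R dsum_out dsum_out_linear.

Lemma dsum_out_in a (v : V a) : dsum_out (dsum_in v) = f a v.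
Proof.
rewrite (@dsum_outE _ [set a]) //; first by rewrite fsbig_set1 /= dfwith_in.
move=> b /= h; apply: contrapT => /eqP; rewrite eq_sym => ab.
by rewrite dfwith_out ?eqxx in h.
Qed.

End DirectSumInOut.

Lemma dsum_decomp (F : fieldType) (A : choiceType) (V : A -> lmodType F)
  (x : dsum V) : x = \sum_(a \in [set a | x a != 0]) dsum_in (x a).
Proof.
rewrite fsbig_finite; last exact: dsum_fin.
apply: dsumP => b.
pose ev (y : dsum V) := y b.
have ev0 : ev 0 = 0 by [].
have evD : {morph ev : y z / y + z} by [].
rewrite -[RHS]/(ev _) (big_morph ev evD ev0) /ev.
have [xb|xb] := eqVneq (x b) 0.
  rewrite xb big_seq big1 // => a; rewrite in_fset_set; last exact: dsum_fin.
  move=> /set_mem /= xa; rewrite /= dfwith_out //.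
  by apply: contra_neq xa => ->.
rewrite (bigD1_seq b) /=; last 2 first.
- by rewrite in_fset_set; [exact/mem_set | exact: dsum_fin].
- exact: finmap.fset_uniq.
rewrite dfwith_in big1 ?addr0 // => a ab; by rewrite dfwith_out.
Qed.

Lemma dsum_ext (F : fieldType) (A : choiceType) (V : A -> lmodType F)
    (W : lmodType F) (f g : {linear dsum V -> W}) :
  (forall a (v : V a), f (dsum_in v) = g (dsum_in v)) -> f =1 g.
Proof.
move=> fg x; rewrite (dsum_decomp x) fsbig_finite; last exact: dsum_fin.
by rewrite !linear_sum; apply: eq_bigr => a _; exact: fg.
Qed.
Arguments dsum_in {F A} V [a] v.

Section QuotientBySpan.
Context {F : fieldType} {V : lmodType F} (R : set V).

(* A submodClosed predicate contains 0 and is closed under addition and scaling,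
   i.e. it is a linear subspace, since -1 is a scalar. *)
Definition in_span : {pred V} := fun v =>
  `[< forall W : submodClosed V, (forall r, R r -> r \in W) -> v \in W >].

Lemma in_span_gen r : R r -> r \in in_span.
Proof. by move=> Rr; apply/asboolP => W; exact. Qed.

Fact in_span_submod : submod_closed in_span.
Proof.
split=> [|k u v /asboolP hu /asboolP hv]; apply/asboolP => W RW.
  exact: rpred0.
by rewrite rpredD ?rpredZ ?hu ?hv.
Qed.
HB.instance Definition _ := GRing.isSubmodClosed.Build F V in_span in_span_submod.

Definition span_quot : Type := Quotient.quot in_span.
HB.instance Definition _ := Choice.on span_quot.
HB.instance Definition _ := GRing.Zmodule.on span_quot.

Definition span_pi (v : V) : span_quot := \pi_(Quotient.quot in_span) v.

Lemma span_pi_eq u v : (span_pi u = span_pi v) <-> (u - v \in in_span).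
Proof. by rewrite Quotient.idealrBE; split=> /eqP. Qed.

Lemma span_piK q : span_pi (repr (q : Quotient.quot in_span)) = q.
Proof. exact: reprK. Qed.

Fact span_piD u v : span_pi (u + v) = span_pi u + span_pi v.
Proof. exact: (@pi_addr _ _ _ _ _ (Quotient.quot in_span)). Qed.

Definition span_scale (k : F) (q : span_quot) : span_quot :=
  span_pi (k *: repr (q : Quotient.quot in_span)).

Fact span_scale_pi k v : span_scale k (span_pi v) = span_pi (k *: v).
Proof.
apply/span_pi_eq; rewrite -scalerBr rpredZ //.
by apply/span_pi_eq; exact: span_piK.
Qed.

Fact span_scaleA k l q : span_scale k (span_scale l q) = span_scale (k * l) q.
Proof. by rewrite -(span_piK q) !span_scale_pi scalerA. Qed.
Fact span_scale1 : left_id 1 span_scale.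
Proof. by move=> q; rewrite -(span_piK q) span_scale_pi scale1r. Qed.
Fact span_scaleDr : right_distributive span_scale +%R.
Proof.
move=> k p q; rewrite -(span_piK p) -(span_piK q).
by rewrite -span_piD !span_scale_pi -span_piD scalerDr.
Qed.
Fact span_scaleDl q : {morph span_scale^~ q : k l / k + l}.
Proof.
by move=> k l; rewrite -(span_piK q) !span_scale_pi -span_piD scalerDl.
Qed.
HB.instance Definition _ := GRing.Zmodule_isLmodule.Build F span_quot
  span_scaleA span_scale1 span_scaleDr span_scaleDl.

Fact span_pi_linear : linear span_pi.
Proof. by move=> k u v; rewrite span_piD -span_scale_pi. Qed.
HB.instance Definition _ :=
  GRing.isLinear.Build F V span_quot *:%R span_pi span_pi_linear.

Context {U : lmodType F} (f : {linear V -> U}) (fR : forall r, R r -> f r = 0).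

Fact in_span_ker v : v \in in_span -> f v = 0.
Proof.
pose K : {pred V} := fun v => f v == 0.
have K_closed : submod_closed K.
  split=> [|k x y /eqP fx /eqP fy]; apply/eqP; first exact: linear0.
  by rewrite linearP fx fy scaler0 addr0.
pose HK := GRing.isSubmodClosed.Build F V K K_closed.
pose KW : submodClosed V := HB.pack K HK.
move=> /asboolP/(_ KW) h; apply/eqP; apply: h => r /fR fr; exact/eqP.
Qed.

Definition span_lift of forall r, R r -> f r = 0 :=
  fun q : span_quot => f (repr (q : Quotient.quot in_span)).

Lemma span_lift_pi v : span_lift fR (span_pi v) = f v.
Proof.
apply/eqP; rewrite -subr_eq0 -linearB; apply/eqP/in_span_ker/span_pi_eq.
exact: span_piK.
Qed.

Fact span_lift_linear : linear (span_lift fR).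
Proof.
move=> k p q; rewrite -(span_piK p) -(span_piK q) -linearP !span_lift_pi.
exact: linearP.
Qed.
HB.instance Definition _ :=
  GRing.isLinear.Build F span_quot U *:%R (span_lift fR) span_lift_linear.

End QuotientBySpan.

(* M t may be infinite-dimensional, so the rank is not taken from matrices or
   vectType: the image of f is spanned by finitely many values of f. *)
Definition finite_rank (F : fieldType) (V W : lmodType F) (f : {linear V -> W}) :=
  exists (n : nat) (v : 'I_n -> V), forall x : V,
    exists c : 'I_n -> F, f x = \sum_(i < n) c i *: f (v i).

Section Persistence.
Context (F : fieldType) {d : Order.disp_t} (T : orderType d).

Record persmod := PersMod {
  pm_obj :> T -> lmodType F;
  pm_map : forall s t : T, (s <= t)%O -> {linear pm_obj s -> pm_obj t};
  pm_map_id : forall (t : T) (tt : (t <= t)%O) (x : pm_obj t), pm_map tt x = x;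
  pm_map_comp : forall (r s t : T) (rs : (r <= s)%O) (st : (s <= t)%O)
    (rt : (r <= t)%O) (x : pm_obj r), pm_map rt x = pm_map st (pm_map rs x) }.

Record pm_hom (M N : persmod) := PMHom {
  pm_hom_at :> forall t : T, {linear M t -> N t};
  pm_hom_nat : forall (s t : T) (st : (s <= t)%O) (x : M s),
    pm_hom_at t (pm_map M st x) = pm_map N st (pm_hom_at s x) }.

Definition pm_iso (M N : persmod) := exists (f : pm_hom M N) (g : pm_hom N M),
  forall t : T, cancel (f t) (g t) /\ cancel (g t) (f t).

Definition qtame (M : persmod) :=
  forall (s t : T) (st : (s < t)%O), finite_rank (pm_map M (ltW st)).

Section LeftColimit.
Context (M : persmod) (t : T).

Local Notation below := {s : T | (s < t)%O}.

Definition below_obj (s : below) : lmodType F := M (val s).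

Definition colim_rel : set (dsum below_obj) :=
  [set r | exists (s s' : below) (ss' : (val s <= val s')%O) (x : M (val s)),
    r = dsum_in below_obj (x : below_obj s)
        - dsum_in below_obj (pm_map M ss' x : below_obj s')].

(* The colimit of M over {s | s < t} is the direct sum of the M s modulo the
   identification of each x with its images under the structure maps; it is the
   zero space if no s < t exists. See left_colim_universal. *)
Definition left_colim : lmodType F := span_quot colim_rel.

Definition left_colim_in (s : below) (x : M (val s)) : left_colim :=
  span_pi colim_rel (dsum_in below_obj (x : below_obj s)).

Definition colim_leg (s : below) : {linear below_obj s -> M t} :=
  pm_map M (ltW (valP s)).

Fact colim_rel_out r : colim_rel r -> dsum_out colim_leg r = 0.
Proof.
case=> s [s' [ss' [x ->]]]; rewrite linearB /= !dsum_out_in /colim_leg.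
by rewrite -(pm_map_comp ss' (ltW (valP s')) (ltW (valP s))) subrr.
Qed.

Definition left_colim_map : {linear left_colim -> M t} := span_lift colim_rel_out.

Lemma left_colim_map_in (s : below) (x : M (val s)) :
  left_colim_map (left_colim_in (s := s) x) = pm_map M (ltW (valP s)) x.
Proof. exact: (etrans (span_lift_pi colim_rel_out _) (dsum_out_in colim_leg _)). Qed.

Lemma left_colim_in_compat (s s' : below) (ss' : (val s <= val s')%O)
  (x : M (val s)) : left_colim_in (s := s') (pm_map M ss' x) = left_colim_in (s := s) x.
Proof.
apply/span_pi_eq; rewrite -opprB rpredN; apply: in_span_gen.
by exists s, s', ss', x.
Qed.

Lemma left_colim_universal (W : lmodType F)
    (g : forall s : below, {linear M (val s) -> W}) :
  (forall (s s' : below) (ss' : (val s <= val s')%O) (x : M (val s)),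
    g s' (pm_map M ss' x) = g s x) ->
  exists h : {linear left_colim -> W},
    (forall (s : below) (x : M (val s)), h (left_colim_in (s := s) x) = g s x) /\
    (forall h' : {linear left_colim -> W},
      (forall (s : below) (x : M (val s)), h' (left_colim_in (s := s) x) = g s x) ->
      h' =1 h).
Proof.
move=> g_compat; pose g' (s : below) : {linear below_obj s -> W} := g s.
have g_rel r : colim_rel r -> dsum_out g' r = 0.
  case=> s [s' [ss' [x ->]]]; rewrite linearB /= !dsum_out_in /g'.
  by rewrite g_compat subrr.
have hin (s : below) (x : M (val s)) :
    span_lift g_rel (left_colim_in (s := s) x) = g s x.
  exact: (etrans (span_lift_pi g_rel _) (dsum_out_in g' _)).
exists (span_lift g_rel); split=> // h' h'in q; rewrite -(span_piK q).
pose H' : {linear dsum below_obj -> W} := h' \o span_pi colim_rel.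
pose H : {linear dsum below_obj -> W} := span_lift g_rel \o span_pi colim_rel.
apply: (@dsum_ext _ _ _ _ H' H) => s x.
exact: etrans (h'in s x) (esym (hin s x)).
Qed.

End LeftColimit.

Definition lower_semicontinuous (M : persmod) :=
  forall t : T, bijective (left_colim_map M t).

Section DirectSumModule.
Context {A : Type} (M : A -> persmod).

Definition pm_dsum_map (s t : T) (st : (s <= t)%O) :
    {linear dsum (fun a => M a s) -> dsum (fun a => M a t)} :=
  dsum_map (fun a => pm_map (M a) st).

Fact pm_dsum_id (t : T) (tt : (t <= t)%O) x : pm_dsum_map tt x = x.
Proof. by apply: dsumP => a; exact: pm_map_id. Qed.

Fact pm_dsum_comp (r s t : T) (rs : (r <= s)%O) (st : (s <= t)%O)
  (rt : (r <= t)%O) x : pm_dsum_map rt x = pm_dsum_map st (pm_dsum_map rs x).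
Proof. by apply: dsumP => a; exact: pm_map_comp. Qed.

Definition pm_dsum : persmod := PersMod pm_dsum_id pm_dsum_comp.

End DirectSumModule.

Record order_interval := OrderInterval {
  itv_set :> set T;
  itv_nonempty : itv_set !=set0;
  itv_convex : forall s u t : T, itv_set s -> itv_set t ->
    (s <= u)%O -> (u <= t)%O -> itv_set u }.

Section IntervalModule.
Variable I : order_interval.

Definition itv_obj_of (b : bool) : lmodType F :=
  if b then (F^o : lmodType F) else ('rV[F]_0 : lmodType F).

Definition itv_map_of (b c : bool) : {linear itv_obj_of b -> itv_obj_of c} :=
  match b, c return {linear itv_obj_of b -> itv_obj_of c} with
  | true, true => idfun
  | _, _ => \0
  end.

Definition itv_obj (t : T) : lmodType F := itv_obj_of `[< itv_set I t >].

Definition itv_map (s t : T) (_ : (s <= t)%O) : {linear itv_obj s -> itv_obj t} :=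
  itv_map_of `[< itv_set I s >] `[< itv_set I t >].

Fact itv_map_id (t : T) (tt : (t <= t)%O) x : itv_map tt x = x.
Proof.
rewrite /itv_map; move: x; rewrite /itv_obj; case: asboolP => //= _ x.
by apply/rowP; case.
Qed.

Fact itv_map_comp (r s t : T) (rs : (r <= s)%O) (st : (s <= t)%O)
  (rt : (r <= t)%O) x : itv_map rt x = itv_map st (itv_map rs x).
Proof.
rewrite /itv_map; move: x; rewrite /itv_obj.
have : `[< itv_set I r >] -> `[< itv_set I t >] -> `[< itv_set I s >].
  by move=> /asboolP Ir /asboolP It; apply/asboolP; exact: itv_convex Ir It rs st.
case: `[< itv_set I r >]; case: `[< itv_set I s >]; case: `[< itv_set I t >] => //= h x.
by have := h isT isT.
Qed.

Definition itv_mod : persmod := PersMod itv_map_id itv_map_comp.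

End IntervalModule.

Definition has_barcode (M : persmod) :=
  exists (A : Type) (I : A -> order_interval), pm_iso M (pm_dsum (fun a => itv_mod (I a))).

Definition dense_order := forall s t : T, (s < t)%O -> exists u : T, (s < u < t)%O.

Definition coinitial (N I : set T) :=
  N `<=` I /\ forall t, I t -> exists2 s, N s & (s <= t)%O.

Definition countably_coinitial (I : set T) :=
  exists2 N : set T, countable N & coinitial N I.

End Persistence.

(* Main.v *)
Require Import Defs.
From HB Require Import structures.
From mathcomp Require Import all_boot all_order all_algebra.
From mathcomp Require Import boolp classical_sets cardinality fsbigop.

(** A persistence module that is q-tame and lower semi-continuous has a barcode
    because every vector has a well-defined birth, and the vectors with a given
    birth can be organised by finite-dimensional arguments.

    Lower semi-continuity enters through the surjectivity of colim -> M t: every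
    nonzero vector of M t comes from some M s with s < t
    (lower_semicontinuous_im), and so lies in im(M s -> M t), which is finite
    dimensional by q-tameness. The set U of all parameters from which v comes,
    together with those above t, is an up-set without least element, the birth
    cut of v. Then v lies in the intersection of the images im(M s -> M t) with
    s in U, but in none of the images with s outside U.

    Fix such an up-set U. A section over U is a compatible family of vectors
    x t, t in U; a nonzero one spans a copy of an interval module, supported on
    the t in U with x t <> 0. As U has a countable coinitial subset and the
    images are finite dimensional, the Mittag-Leffler argument extends every
    vector of the intersection above to a section (upper_im_section). By Zorn's
    lemma there is a maximal set S of sections such that for each t in U the
    nonzero values at t are independent modulo the vectors born before U, that
    is, coming from a parameter outside U. Maximality forces these values to
    span the whole intersection modulo the vectors born before U
    (exists_section_basis): a section whose value at t is missed can be
    corrected so that it vanishes as soon as it falls into the span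
    (correct_section), and can then be added to S. The correction has to work at
    all these later parameters simultaneously; finite dimension makes the
    decreasing family of affine solution spaces stabilise.

    The bars are all pairs (U, x) with x in the basis chosen for U. At each t,
    the living bars give a basis of M t. In a linear relation, consider a bar
    with the smallest U: every other bar has the same U or is born before it, so
    the independence for this U is violated (bars_free). Conversely, a vector
    outside the span and coming from the smallest possible image would, after
    subtracting bars with its own birth cut, be born strictly earlier, that is,
    come from a smaller image (bars_span). *)

Set Implicit Arguments.
Unset Strict Implicit.
Unset Printing Implicit Defensive.

Import Order.TTheory GRing.Theory.
Local Open Scope classical_set_scope.
Local Open Scope ring_scope.

(** * Subspaces and finite dimension *)

Definition subspace (F : fieldType) (V : lmodType F) (P : set V) :=
  P 0 /\ forall k u v, P u -> P v -> P (k *: u + v).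

Lemma in_span_ind (F : fieldType) (V : lmodType F) (R P : set V) :
  subspace P -> R `<=` P -> forall v, v \in in_span R -> P v.
Proof.
case=> P0 PD RP v; pose K : {pred V} := fun v => `[< P v >].
have K_closed : submod_closed K.
  by split=> [|k x y /asboolP Px /asboolP Py]; apply/asboolP; [|exact: PD].
pose HK := GRing.isSubmodClosed.Build F V K K_closed.
pose KW : submodClosed V := HB.pack K HK.
by move=> /asboolP/(_ KW) h; apply/asboolP; apply: h => r /RP Pr; exact/asboolP.
Qed.

Lemma subspace_in_span (F : fieldType) (V : lmodType F) (R : set V) :
  subspace [set v | v \in in_span R].
Proof. by split=> [|k u v uR vR]; [exact: rpred0 | rewrite /= rpredD ?rpredZ]. Qed.

Lemma in_spanS (F : fieldType) (V : lmodType F) (R S : set V) v :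
  R `<=` S -> v \in in_span R -> v \in in_span S.
Proof.
move=> RS; apply: (in_span_ind (subspace_in_span S)) => r /RS.
exact: in_span_gen.
Qed.

(** A matrix of maximal rank among those with all rows in P spans P: a missing
    vector would enlarge the row space. *)
Lemma subspace_row_space (F : fieldType) n (P : set 'rV[F]_n) :
  subspace P -> exists A : 'M[F]_n, forall v, P v <-> (v <= A)%MS.
Proof.
case=> P0 PD.
pose inP (A : 'M[F]_n) := forall v : 'rV_n, (v <= A)%MS -> P v.
pose rk r := `[< exists A : 'M[F]_n, inP A /\ \rank A = r >].
have rk0 : exists r, rk r.
  exists 0%N; apply/asboolP; exists 0; rewrite mxrank0; split=> // v.
  by rewrite submx0 => /eqP->.
have rkn r : rk r -> (r <= n)%N.
  by move=> /asboolP[A [_ <-]]; exact: rank_leq_row.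
case: (ex_maxnP rk0 rkn) => r /asboolP[A [AP <-]] rmax.
exists A => v; split=> [Pv|]; last exact: AP.
have AvP : inP (A + v)%MS.
  move=> w /sub_addsmxP[[a b] /= ->].
  rewrite addrC [b]mx11_scalar mul_scalar_mx; apply: PD => //.
  by apply: AP; rewrite submxMl.
have /rmax : rk (\rank (A + v)%MS) by apply/asboolP; exists (A + v)%MS.
by rewrite (geq_leqif (mxrank_leqif_sup (addsmxSl A v))) addsmx_sub => /andP[].
Qed.

(** The well-foundedness of the subspaces of a finite-dimensional space, in the
    form that serves inside spaces of infinite dimension: the subspaces K j are
    compared only on the combinations of b, hence pulled back to row spaces, and
    a trace of least rank is minimal. *)
Lemma exists_minimal_trace (F : fieldType) (V : lmodType F) n (b : 'I_n -> V)
    (J : Type) (P : set J) (K : J -> set V) :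
    (forall j, subspace (K j)) -> P !=set0 ->
  let tr (c : 'I_n -> F) := \sum_(i < n) c i *: b i in
  exists2 j, P j & forall i, P i -> (forall c, K i (tr c) -> K j (tr c)) ->
    forall c, K j (tr c) -> K i (tr c).
Proof.
move=> Ksub [j0 Pj0] tr.
pose trv (r : 'rV[F]_n) := tr (r 0).
have trvE c : tr c = trv (\row_i c i).
  by apply: eq_bigr => i _; rewrite mxE.
have /choice[A AK] j : exists A : 'M[F]_n, forall r, K j (trv r) <-> (r <= A)%MS.
  apply: subspace_row_space; have [K0 KD] := Ksub j; split.
    by rewrite /trv /tr big1 // => i _; rewrite mxE scale0r.
  move=> k u v Ku Kv; rewrite /trv; have -> : tr ((k *: u + v) 0) = k *: trv u + trv v.
    rewrite /trv /tr scaler_sumr -big_split; apply: eq_bigr => i _.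
    by rewrite !mxE scalerDl scalerA.
  exact: KD.
pose rk r := `[< exists2 j, P j & \rank (A j) = r >].
have rkj0 : exists r, rk r by exists (\rank (A j0)); apply/asboolP; exists j0.
case: (ex_minnP rkj0) => r /asboolP[j Pj <-] rmin.
exists j => // i Pi Kij c.
have sij : (A i <= A j)%MS.
  apply/rV_subP => v /AK; rewrite /trv => /Kij; exact: (AK j v).1.
rewrite trvE => /AK cj; apply/AK; apply: submx_trans cj _.
rewrite -(geq_leqif (mxrank_leqif_sup sij)).
by apply: rmin; apply/asboolP; exists i.
Qed.

(** * Images of the structure maps *)

Section Transport.
Context {F : fieldType} {d : Order.disp_t} {T : orderType d}.
Variable M : persmod F T.
Implicit Types r s t : T.

(** Making the structure maps total, by zero outside s <= t, removes the order
    proofs from the terms, so that families of vectors can be rewritten freely. *)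
Definition tr s t : {linear M s -> M t} :=
  match @idP (s <= t)%O with
  | ReflectT st => pm_map M st
  | ReflectF _ => \0
  end.

Lemma trE s t (st : (s <= t)%O) : tr s t =1 pm_map M st.
Proof. by rewrite /tr; case: {-}_ / idP => // st' v; rewrite (bool_irrelevance st' st). Qed.

Lemma tr_id t (v : M t) : tr t t v = v.
Proof. by rewrite (trE (lexx t)) pm_map_id. Qed.

Lemma tr_comp r s t (v : M r) :
  (r <= s)%O -> (s <= t)%O -> tr s t (tr r s v) = tr r t v.
Proof.
move=> rs st; have rt := le_trans rs st.
by rewrite (trE rs) (trE st) (trE rt) -pm_map_comp.
Qed.

Definition im s t : set (M t) := [set v | exists w, tr s t w = v].
Arguments im : clear implicits.

Lemma im_subspace s t : subspace (im s t).
Proof.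
split=> [|k _ _ [u <-] [v <-]]; first by exists 0; rewrite linear0.
by exists (k *: u + v); rewrite linearP.
Qed.

Lemma im_mono r s t : (r <= s)%O -> (s <= t)%O -> im r t `<=` im s t.
Proof. by move=> rs st _ [w <-]; exists (tr r s w); rewrite tr_comp. Qed.

(** The vectors coming from L form a subspace since images grow with their
    source. Zero is allowed apart because L may be empty. *)
Lemma im_bigcup_subspace (L : set T) t : (forall s, L s -> (s <= t)%O) ->
  subspace [set v | v != 0 -> exists2 s, L s & im s t v].
Proof.
move=> Lt; split=> [|k u v uE vE]; first by rewrite /= eqxx.
have [->|/uE[s Ls us] /=] := eqVneq u 0; first by rewrite scaler0 add0r.
have [->|/vE[r Lr vr] _] := eqVneq v 0.
  by exists s => //; apply: (im_subspace s t).2 => //; exact: (im_subspace s t).1.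
have [sr|/ltW rs] := leP s r; [exists r|exists s] => //.
  by apply: (im_subspace r t).2 => //; exact: im_mono (Lt r Lr) _ us.
by apply: (im_subspace s t).2 => //; exact: im_mono (Lt s Ls) _ vr.
Qed.

(** The colimit map is onto, and an element of the colimit is a finite sum of
    vectors of the M s with s < t; the largest of these s serves for all. *)
Lemma lower_semicontinuous_im t (v : M t) :
  lower_semicontinuous M -> v != 0 -> exists2 s, (s < t)%O & im s t v.
Proof.
move=> /(_ t)[g _ gK]; rewrite -(gK v) -(span_piK (g v)).
rewrite [left_colim_map _ _ _](span_lift_pi (@colim_rel_out _ _ _ M t) _).
set x : dsum _ := repr _ => /=.
rewrite (dsum_outE (colim_leg M (t:=t)) (dsum_fin x)) //.
rewrite fsbig_finite; last exact: dsum_fin.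
have [E0 ED] := @im_bigcup_subspace [set s | (s < t)%O] t (fun s => @ltW _ _ s t).
apply: (big_ind [set u : M t | u != 0 -> exists2 s, (s < t)%O & im s t u]).
- exact: E0.
- by move=> u w Eu Ew; rewrite -(scale1r u); exact: ED.
- case=> s st _ _; exists s => //.
  by eexists; exact: trE.
Qed.

(** Finite dimension in the form used below: it serves for images, for kernels and
    for the induction that proves that the bars span. *)
Lemma qtame_minimal s t (J : Type) (P : set J) (K : J -> set (M t)) :
    qtame M -> (s < t)%O -> (forall j, subspace (K j)) ->
    (forall j, P j -> K j `<=` im s t) -> P !=set0 ->
  exists2 j, P j & forall i, P i -> K i `<=` K j -> K j `<=` K i.
Proof.
move=> Mq st Ksub Kim P0; have [n [b bE]] := Mq s t st.
have [j Pj jmin] := exists_minimal_trace (fun i => tr s t (b i)) Ksub P0.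
exists j => // i Pi Kij v Kjv.
have [w vE] := Kim j Pj v Kjv; have [c wE] := bE w.
have {}vE : v = \sum_(i < n) c i *: tr s t (b i).
  rewrite -vE (trE (ltW st)) wE; apply: eq_bigr => k _.
  by rewrite (trE (ltW st)).
by rewrite vE; apply: jmin => // [e /Kij //|]; rewrite -vE.
Qed.

End Transport.
Arguments im {F d T} M s t _.

(** * Sections over an up-set and the Mittag-Leffler argument *)

Section UpSet.
Context {F : fieldType} {d : Order.disp_t} {T : orderType d}.
Variable M : persmod F T.
Hypotheses (Mq : qtame M)
  (T_coinitial : forall I : order_interval T, countably_coinitial I).
Variable U : set T.
Implicit Types r s t : T.

(** Possible birth cuts. A least element is excluded because, by lower
    semi-continuity, a nonzero vector always comes from earlier parameters. *)
Definition open_upset :=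
  (forall s t, U s -> (s <= t)%O -> U t) /\
  (forall t, U t -> exists2 s, U s & (s < t)%O).

Hypothesis Uopen : open_upset.
Let Uup : forall s t, U s -> (s <= t)%O -> U t := Uopen.1.

(** The vectors of M t that are alive on all of U below t: their births are at the
    cut U or earlier. *)
Definition upper_im t : set (M t) :=
  [set v | forall r, U r -> (r <= t)%O -> im M r t v].
Arguments upper_im : clear implicits.

Definition pm_section (x : forall t, M t) :=
  forall s t, U s -> (s <= t)%O -> tr M s t (x s) = x t.

(** Among the images im(M s -> M t), s in U below some s0 < t, a minimal one exists
    by q-tameness; as images are nested, it is the intersection of all. *)
Lemma upper_im_attained t :
  U t -> exists s, [/\ U s, (s < t)%O & im M s t `<=` upper_im t].
Proof.
move=> Ut; have [s0 Us0 s0t] := Uopen.2 t Ut.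
have [||s [Us ss0] smin] := @qtame_minimal _ _ _ M s0 t T
    [set s | U s /\ (s <= s0)%O] (fun s => im M s t) Mq s0t (fun s => im_subspace M s t).
- by move=> s [_ ss0]; apply: im_mono => //; exact: ltW.
- by exists s0.
exists s; split=> //; first exact: le_lt_trans s0t.
move=> v vs r Ur rt; case: (leP r s) => [rs|/ltW sr]; last exact: im_mono vs.
apply: smin vs; first by split=> //; exact: le_trans rs ss0.
by apply: im_mono => //; exact: le_trans ss0 (ltW s0t).
Qed.

(** The surjectivity required by the Mittag-Leffler argument: if im(M r -> M s) is
    the whole intersection at s, lift v to M r and push the lift to M s. *)
Lemma upper_im_lift s t v : U s -> (s <= t)%O -> upper_im t v ->
  exists2 w, upper_im s w & tr M s t w = v.
Proof.
move=> Us st vU; have [r [Ur rs rU]] := upper_im_attained Us.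
have [w wE] := vU r Ur (le_trans (ltW rs) st).
exists (tr M r s w); first by apply: rU; exists w.
by rewrite tr_comp // ltW.
Qed.

Lemma coinitial_sequence : U !=set0 ->
  exists e : nat -> T, (forall n, U (e n)) /\ forall t, U t -> exists n, (e n <= t)%O.
Proof.
move=> U0; have Uconv s u t : U s -> U t -> (s <= u)%O -> (u <= t)%O -> U u.
  by move=> Us _ su _; exact: Uup Us su.
have [N /countable_injP[f finj] [NU Nco]] := T_coinitial (OrderInterval U0 Uconv).
have [t0 Ut0] := U0; exists (fun n => xget t0 [set s | N s /\ f s = n]); split.
  by move=> n; case: xgetP => // s _ [/NU].
move=> t /Nco[s Ns st]; exists (f s); case: xgetP => [r _ [Nr fr]|/(_ s)[]//].
by rewrite (finj r s) // inE.
Qed.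

(** Lift v step by step along a decreasing coinitial sequence starting at t; the
    value at s is then pushed from any member of the sequence below s. *)
Lemma upper_im_section t v : U t -> upper_im t v ->
  exists2 x, pm_section x & x t = v.
Proof.
move=> Ut vU; have [e [eU eco]] := coinitial_sequence (ex_intro _ t Ut).
(* The value type M s changes at each step, so the sequence runs over pairs (s, w). *)
pose good (p : {s : T & M s}) := U (tag p) /\ upper_im (tag p) (tagged p).
have step n p : exists q, good p -> [/\ good q, (tag q <= tag p)%O,
    (tag q <= e n)%O & tr M (tag q) (tag p) (tagged q) = tagged p].
  case: (pselect (good p)) => [[Up pU]|]; last by exists p.
  pose s := Order.min (tag p) (e n).
  have Us : U s by rewrite /s minEle; case: ifP.
  have sp : (s <= tag p)%O by rewrite ge_min lexx.
  have [w wU wE] := upper_im_lift Us sp pU.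
  by exists (Tagged (fun s => M s) w); split=> //; rewrite ge_min lexx orbT.
pose f n p := sval (cid (step n p)).
have fP n p : good p -> _ := svalP (cid (step n p)).
pose p n : {s : T & M s} := iteri n f (Tagged (fun s => M s) v).
have pgood n : good (p n) by elim: n => // n /(fP n)[].
have ple m n : (m <= n)%N -> (tag (p n) <= tag (p m))%O /\
    tr M (tag (p n)) (tag (p m)) (tagged (p n)) = tagged (p m).
  elim: n => [|n IHn]; first by rewrite leqn0 => /eqP->; rewrite tr_id.
  rewrite leq_eqVlt => /predU1P[->|]; first by rewrite tr_id.
  rewrite ltnS => /IHn[nm nmE]; have [_ pn _ pnE] := fP n _ (pgood n).
  by split; [exact: le_trans pn nm | rewrite -nmE -[in RHS]pnE tr_comp].
have /choice[N NP] s : exists n, U s -> (tag (p n) <= s)%O.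
  case: (pselect (U s)) => [Us|]; last by exists 0%N.
  have [n ns] := eco s Us; exists n.+1 => _; apply: le_trans ns.
  by have [] := fP n _ (pgood n).
pose x s := tr M (tag (p (N s))) s (tagged (p (N s))).
have xE n s : U s -> (tag (p n) <= s)%O -> x s = tr M (tag (p n)) s (tagged (p n)).
  move=> Us ns; rewrite /x; have Ns := NP s Us.
  case/orP: (leq_total (N s) n) => /ple[le E].
    by rewrite -[in LHS]E tr_comp.
  by rewrite -[in RHS]E tr_comp.
exists x; last by rewrite (xE 0%N) ?tr_id.
move=> s r Us sr; have Ns := NP s Us.
by rewrite (xE (N s) r (Uup Us sr) (le_trans Ns sr)) (xE (N s) s) // tr_comp.
Qed.

(** * A basis of sections for a single up-set *)

(** Values of S at t together with the vectors born before U. Membership of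
    nonzero values in this span is the obstruction to independence modulo the
    vectors born before U, which avoids forming quotient spaces. *)
Definition born_span (S : set (forall t, M t)) t : {pred M t} :=
  in_span [set v | (exists2 s, ~ U s & im M s t v) \/ exists2 y, S y & y t = v].
Arguments born_span : clear implicits.

Lemma born_spanS S S' t v :
  S `<=` S' -> v \in born_span S t -> v \in born_span S' t.
Proof.
move=> SS'; apply: in_spanS => {}v [|[y Sy yt]]; first by left.
by right; exists y => //; exact: SS'.
Qed.

(** A vector in the span can be subtracted from a section at all parameters of U at
    once, without affecting membership in the span. *)
Lemma born_span_section S t v : S `<=` pm_section -> U t -> v \in born_span S t ->
  exists z, [/\ pm_section z, z t = v & forall r, U r -> z r \in born_span S r].
Proof.
move=> Ssec Ut.
move: v; apply: in_span_ind; last first.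
  move=> v [[s nUs [w wE]]|[y Sy yE]].
    exists (fun r => tr M s r w); split=> // [r r' Ur rr'|r Ur].
      by rewrite tr_comp //; case: (leP s r) => // /ltW/(Uup Ur).
    by apply: in_span_gen; left; exists s => //; exists w.
  exists y; split=> // [|r Ur]; first exact: Ssec.
  by apply: in_span_gen; right; exists y.
split=> [|k u v [zu [zus zuE zuW]] [zv [zvs zvE zvW]]].
  exists (fun=> 0); split=> // [r r' _ _|r _]; [exact: linear0|exact: rpred0].
exists (fun r => k *: zu r + zv r); split=> [r r' Ur rr'||r Ur].
- by rewrite linearP zus // zvs.
- by rewrite zuE zvE.
- by rewrite rpredD ?rpredZ ?zuW ?zvW.
Qed.

Lemma born_span_push S t r v : S `<=` pm_section -> U t -> (t <= r)%O ->
  v \in born_span S t -> tr M t r v \in born_span S r.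
Proof.
move=> Ssec Ut tr_ /(born_span_section Ssec Ut)[z [zs <- zW]].
by rewrite zs // zW //; exact: Uup tr_.
Qed.

Lemma born_span_lift S t r v : S `<=` pm_section -> U t -> (t <= r)%O ->
  v \in born_span S r -> exists2 w, w \in born_span S t & tr M t r w = v.
Proof.
move=> Ssec Ut le_tr.
move: v; apply: in_span_ind; last first.
  move=> v [[s nUs [w wE]]|[y Sy yE]].
    exists (tr M s t w).
      by apply: in_span_gen; left; exists s => //; exists w.
    by rewrite tr_comp //; case: (leP s t) => // /ltW/(Uup Ut).
  exists (y t); first by apply: in_span_gen; right; exists y.
  by rewrite (Ssec y).
split=> [|k _ _ [u uW <-] [v vW <-]]; first by exists 0; rewrite ?linear0 ?rpred0.
by exists (k *: u + v); rewrite ?linearP ?rpredD ?rpredZ.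
Qed.

(** This places the span at t in a finite-dimensional space: elements of S come
    from every s in U, and vectors born before U come from below s. *)
Lemma born_span_im S s t v : S `<=` pm_section -> U s -> (s <= t)%O ->
  v \in born_span S t -> im M s t v.
Proof.
move=> Ssec Us st; apply: (in_span_ind (im_subspace M s t)) => {}v.
case=> [[r nUr]|[y Sy <-]]; last by exists (y s); exact: Ssec.
by apply: im_mono => //; case: (leP r s) => // /ltW/(Uup Us).
Qed.

Lemma born_span_setU1 S x t v : v \in born_span (S `|` [set x]) t ->
  exists k, v - k *: x t \in born_span S t.
Proof.
move: v; apply: in_span_ind; last first.
  move=> v [?|[y [Sy|->] <-]]; [exists 0|exists 0|exists 1].
  - by rewrite scale0r subr0; apply: in_span_gen; left.
  - by rewrite scale0r subr0; apply: in_span_gen; right; exists y.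
  - by rewrite scale1r subrr rpred0.
split=> [|k u v [a ua] [b vb]]; first by exists 0; rewrite scale0r subr0 rpred0.
exists (k * a + b); rewrite scalerDl opprD addrACA -scalerA -scalerBr.
by rewrite rpredD ?rpredZ.
Qed.

(** Zero values are exempt, as a section may die. The condition also forces a
    section to die as soon as its value depends on the others and on older
    vectors. *)
Definition independent_sections (S : set (forall t, M t)) :=
  forall x, S x -> [/\ pm_section x, exists2 t, U t & x t != 0 &
    forall t, U t -> x t != 0 -> x t \notin born_span (S `\ x) t].

(** Let R be the set of parameters where x has fallen into the span; it lies above
    t. For r in R the vectors y of the span at t with the same image as x at r form
    a nonempty affine space, which decreases as r decreases to the start of R, and
    whose direction K r is a kernel in a finite-dimensional space. So it is
    constant from some r0 on; a y found at r0 works for all of R, and subtracting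
    the section through y from x makes x vanish on R. *)
Lemma correct_section S x t : S `<=` pm_section -> pm_section x -> U t ->
    x t \notin born_span S t ->
  exists x', [/\ pm_section x', x' t \notin born_span S t &
    forall r, U r -> x' r != 0 -> x' r \notin born_span S r].
Proof.
move=> Ssec xs Ut xt.
suff [z [zs zW zx]] : exists z, [/\ pm_section z,
    forall r, U r -> z r \in born_span S r &
    forall r, U r -> x r \in born_span S r -> z r = x r].
  have notin r : U r -> x r \notin born_span S r -> x r - z r \notin born_span S r.
    by move=> Ur; apply: contra => xzr; rewrite -(subrK (z r) (x r)) rpredD ?zW.
  exists (fun r => x r - z r); split=> [r r' Ur rr'||r Ur xzr].
  - by rewrite linearB xs // zs.
  - exact: notin.
  - by apply: notin => //; apply: contra xzr => /zx->; rewrite ?subrr.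
pose R := [set r | U r /\ x r \in born_span S r].
case: (pselect (R !=set0)) => [R0|nR]; last first.
  exists (fun=> 0); split=> [r r' _ _|r _|r Ur xr]; first exact: linear0.
    exact: rpred0.
  by case: nR; exists r.
have tR r : R r -> (t <= r)%O.
  move=> [Ur xr]; case: leP => // /ltW rt; case/negP: xt.
  by rewrite -(xs r) //; exact: born_span_push.
pose K r := [set y | y \in born_span S t /\ tr M t r y = 0].
have [s Us st] := Uopen.2 t Ut.
have [|||r0 Rr0 r0min] := @qtame_minimal _ _ _ M s t T R K Mq st => //.
- move=> r; split=> [|k u v [uW u0] [vW v0]]; first by rewrite /K /= rpred0 linear0.
  by rewrite /K /= rpredD ?rpredZ // linearP u0 v0 scaler0 addr0.
- by move=> r Rr v [vW _]; apply: born_span_im vW => //; exact: ltW.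
have lift r : R r -> exists2 y, y \in born_span S t & tr M t r y = x r.
  by move=> Rr; apply: born_span_lift => //; [exact: tR|case: Rr].
have [y yW yE] := lift r0 Rr0.
have yR r : R r -> tr M t r y = x r.
  move=> Rr; case: (leP r0 r) => [r0r|/ltW rr0].
    by rewrite -(tr_comp _ (tR r0 Rr0) r0r) yE xs //; case: Rr0.
  have [w wW wE] := lift r Rr.
  have Kyw : K r0 (y - w).
    split; first exact: rpredB.
    by rewrite linearB /= yE -(tr_comp w (tR r Rr) rr0) wE xs ?subrr //; case: Rr.
  have /(_ _ Kyw)[_] : K r0 `<=` K r.
    apply: r0min => // u [uW u0]; split=> //.
    by rewrite -(tr_comp _ (tR r Rr) rr0) u0 linear0.
  by rewrite linearB /= wE => /eqP; rewrite subr_eq0 => /eqP.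
have [z [zs zE zW]] := born_span_section Ssec Ut yW.
exists z; split=> // r Ur xr; rewrite -(zs t) ?zE //; last exact: tR.
exact: yR.
Qed.

(** The exchange argument: if adding x makes some y of S dependent, then either x
    has no part in the dependence, or x itself is in the span of S. *)
Lemma independent_setU1 S x t : independent_sections S -> pm_section x -> U t ->
    x t \notin born_span S t ->
    (forall r, U r -> x r != 0 -> x r \notin born_span S r) ->
  independent_sections (S `|` [set x]).
Proof.
move=> Sind xs Ut xt xW.
have nSx : ~ S x.
  by move=> Sx; case/negP: xt; apply: in_span_gen; right; exists x.
move=> y [Sy|->].
  have [ys y0 yW] := Sind y Sy; split=> // r Ur yr.
  have xDy : (S `|` [set x]) `\ y = (S `\ y) `|` [set x].
    rewrite setDUl; congr (_ `|` _); apply/seteqP; split=> [_ [->]//|_ ->].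
    by split=> // xy; apply: nSx; rewrite xy.
  rewrite xDy; apply/negP => /born_span_setU1[k kW].
  have [kx|kx] := eqVneq (k *: x r) 0.
    by move: kW; rewrite kx subr0; apply/negP; exact: yW.
  move: (kx); rewrite scaler_eq0 negb_or => /andP[k0 xr0].
  case/negP: (xW r Ur xr0); rewrite -(scalerK k0 (x r)) rpredZ //.
  rewrite -[k *: x r](subKr (y r)) rpredB //.
    by apply: in_span_gen; right; exists y.
  by apply: born_spanS kW; exact: subDsetl.
split=> //; first by exists t => //; apply: contraNneq xt => ->; exact: rpred0.
move=> r Ur xr; apply: contra (xW r Ur xr); apply: born_spanS.
by move=> z [[]].
Qed.

Lemma independent_bigcup (C : set (set (forall t, M t))) :
  C `<=` independent_sections -> total_on C subset ->
  independent_sections (\bigcup_(S in C) S).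
Proof.
move=> Cind Ctot x [S CS Sx]; have [xs x0 _] := Cind S CS x Sx.
split=> // t Ut xt; apply/negP => xW.
suff [S' [CS' S'x]] : exists S', [/\ C S', S' x & x t \in born_span (S' `\ x) t].
  by apply/negP; have [_ _] := Cind S' CS' x S'x; exact.
move: {xt} (x t) xW; apply: in_span_ind; last first.
  move=> v [vU|[y [[S' CS' S'y] nyx] yE]].
    by exists S; split=> //; apply: in_span_gen; left.
  have [SS'|S'S] := Ctot _ _ CS CS'.
    exists S'; split=> //; first exact: SS'.
    by apply: in_span_gen; right; exists y.
  by exists S; split=> //; apply: in_span_gen; right; exists y => //; split=> //; exact: S'S.
split=> [|k u v [S1 [CS1 S1x uW]] [S2 [CS2 S2x vW]]].
  by exists S; split=> //; exact: rpred0.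
have [le|le] := Ctot _ _ CS1 CS2; [exists S2|exists S1]; split=> //.
  by rewrite rpredD ?rpredZ //; apply: born_spanS uW; exact: setSD.
by rewrite rpredD ?rpredZ //; apply: born_spanS vW; exact: setSD.
Qed.

(** A maximal independent set of sections spans: a vector outside the span extends
    to a section, and its correction could be added to the set. *)
Lemma exists_section_basis : exists S, independent_sections S /\
  forall t v, U t -> upper_im t v -> v \in born_span S t.
Proof.
have [S [Sind Smax]] := Zorn_bigcup independent_bigcup.
have Ssec : S `<=` pm_section by move=> x /Sind[].
exists S; split=> // t v Ut vU; apply: contrapT => /negP vW.
have [x xs xE] := upper_im_section Ut vU; rewrite -xE in vW.
have [x' [x's x't x'W]] := correct_section Ssec xs Ut vW.
apply: (Smax (S `|` [set x'])); last exact: independent_setU1 x't x'W.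
split=> [y|]; first by left.
move=> /(_ x' (or_intror erefl)) Sx'.
by case/negP: x't; apply: in_span_gen; right; exists x'.
Qed.

End UpSet.
Arguments upper_im {F d T} M U t _.
Arguments born_span {F d T} M U S t _.

(** * Assembling the barcode *)

Lemma pm_iso_bij (F : fieldType) (d : Order.disp_t) (T : orderType d)
    (M N : persmod F T) (g : pm_hom N M) :
  (forall t, injective (g t)) -> (forall t v, exists y, g t y = v) -> pm_iso M N.
Proof.
move=> ginj gsurj.
have hP t : exists h : {linear M t -> N t}, cancel h (g t).
  pose h v := sval (cid (gsurj t v)).
  have hK : cancel h (g t) by move=> v; exact: (svalP (cid (gsurj t v))).
  have h_lin : linear h by exact: can2_linear (inj_can_sym hK (ginj t)) hK.
  pose hL := GRing.isLinear.Build F (M t) (N t) *:%R h h_lin.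
  pose hh : {linear M t -> N t} := HB.pack h hL.
  by exists hh.
pose h t := sval (cid (hP t)).
have hK t : cancel (h t) (g t) := svalP (cid (hP t)).
have h_nat s t (st : (s <= t)%O) (x : M s) :
    h t (pm_map M st x) = pm_map N st (h s x).
  by apply: (ginj t); rewrite hK pm_hom_nat hK.
exists (PMHom h_nat), g => t; split; first exact: hK.
exact: inj_can_sym (hK t) (ginj t).
Qed.

Section IntervalOut.
Context {F : fieldType} {V : lmodType F}.

Definition line_map (v : V) (c : F^o) : V := c *: v.

Fact line_map_linear v : linear (line_map v).
Proof. by move=> k c c'; rewrite /line_map scalerDl -scalerA. Qed.
HB.instance Definition _ v :=
  GRing.isLinear.Build F F^o V *:%R (line_map v) (line_map_linear v).

Definition itv_out (b : bool) (v : V) : {linear itv_obj_of F b -> V} :=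
  match b return {linear itv_obj_of F b -> V} with
  | true => line_map v
  | false => \0
  end.

(** The objects of an interval module are defined by cases on membership; this
    reads the value as a multiple of v and keeps the cases out of the sums. *)
Lemma itv_outE (b : bool) (v : V) (c : itv_obj_of F b) :
  exists k, itv_out b v c = k *: v /\ (c != 0 -> b /\ k != 0).
Proof.
case: b c => c; first by exists c.
exists 0; split; first by rewrite scale0r.
by case/eqP; apply/rowP; case.
Qed.

Lemma itv_out_onto (b : bool) (v : V) : b -> exists c, itv_out b v c = v.
Proof. by case: b => // _; exists (1 : F); rewrite /= /line_map scale1r. Qed.

End IntervalOut.

Lemma itv_out_map (F : fieldType) (V W : lmodType F) (f : {linear V -> W})
    (b c : bool) (v : V) (w : W) (x : itv_obj_of F b) :
    (b -> f v = if c then w else 0) ->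
  itv_out c w (itv_map_of F b c x) = f (itv_out b v x).
Proof.
case: b x => x /= fvw; last by case: c {fvw}; rewrite ?linear0.
rewrite /line_map linearZ /= fvw //.
by case: c {fvw} => //=; rewrite scaler0.
Qed.

Section Barcode.
Context {F : fieldType} {d : Order.disp_t} {T : orderType d}.
Variable M : persmod F T.
Hypotheses (Mq : qtame M) (Mlsc : lower_semicontinuous M).
Variable S : set T -> set (forall t, M t).
Hypothesis Sind : forall U, open_upset U -> independent_sections U (S U).
Hypothesis Sspan : forall U, open_upset U ->
  forall t v, U t -> upper_im M U t v -> v \in born_span M U (S U) t.

(** The cut belongs to the index because the values of a section outside its cut
    carry no meaning, so that it does not determine the interval alone. *)
Definition bar : choiceType :=
  {classic {p : set T * (forall t, M t) | open_upset p.1 /\ S p.1 p.2}}.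

Definition bar_dom (a : bar) : set T := (sval a).1.
Definition bar_sec (a : bar) : forall t, M t := (sval a).2.
Definition alive (a : bar) : set T := [set t | bar_dom a t /\ bar_sec a t != 0].

Lemma bar_eq a b : bar_dom a = bar_dom b -> bar_sec a = bar_sec b -> a = b.
Proof.
case: a b => [[U x] /= p] [[U' x'] /= p']; rewrite /bar_dom /bar_sec /=.
by move=> eU ex; subst; congr exist; exact: Prop_irrelevance.
Qed.

Lemma bar_open a : open_upset (bar_dom a). Proof. exact: (svalP a).1. Qed.

Lemma bar_basis a : S (bar_dom a) (bar_sec a). Proof. exact: (svalP a).2. Qed.

Lemma bar_section a s t : bar_dom a s -> (s <= t)%O ->
  tr M s t (bar_sec a s) = bar_sec a t.
Proof. by have [xs _ _] := Sind (bar_open a) (bar_basis a); exact: xs. Qed.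

Lemma alive_nonempty a : alive a !=set0.
Proof. by have [_ [t Ut xt] _] := Sind (bar_open a) (bar_basis a); exists t. Qed.

Lemma alive_convex a s u t : alive a s -> alive a t ->
  (s <= u)%O -> (u <= t)%O -> alive a u.
Proof.
move=> [Us _] [_ xt] su ut; have Uu := (bar_open a).1 s u Us su.
by split=> //; apply: contraNneq xt => xu; rewrite -(bar_section Uu ut) xu linear0.
Qed.

Definition bar_itv a := OrderInterval (alive_nonempty a) (@alive_convex a).

Lemma bar_dom_total a b : bar_dom a `<=` bar_dom b \/ bar_dom b `<=` bar_dom a.
Proof.
case: (pselect (bar_dom a `<=` bar_dom b)) => [|nab]; first by left.
right=> t bt; apply: contrapT => nat_; apply: nab => s as_.
by case: (leP t s) => [/((bar_open b).1 t s bt)//|/ltW/((bar_open a).1 s t as_)].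
Qed.

(** Birth cuts are nested, so finitely many bars include a youngest one. *)
Lemma minimal_bar (r : seq bar) : r != [::] ->
  exists2 a, a \in r & forall b, b \in r -> bar_dom a `<=` bar_dom b.
Proof.
elim: r => // b [|c r] IHr _.
  by exists b; rewrite ?mem_head // => a; rewrite inE => /eqP->.
have [//|a ar amin] := IHr; have [ab|ba] := bar_dom_total a b.
  exists a; first by rewrite inE ar orbT.
  by move=> e; rewrite inE => /predU1P[->|/amin].
exists b; first exact: mem_head.
by move=> e; rewrite inE => /predU1P[->//|/amin]; exact: subset_trans.
Qed.

(** In a relation solve for a youngest bar a. The other bars have the same cut, and
    are other members of its basis, or a larger cut, and then are born before it.
    So the value of a lies in a span that independence excludes. *)
Lemma bars_free t (k : bar -> F) (r : seq bar) : uniq r ->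
    (forall a, a \in r -> alive a t /\ k a != 0) ->
  \sum_(a <- r) k a *: bar_sec a t = 0 -> r = [::].
Proof.
move=> r_uniq rP sum0; apply/eqP; apply: contraT => /minimal_bar[a ar amin].
have [[Ut xt] ka] := rP a ar.
have [_ _ /(_ t Ut xt)/negP[]] := Sind (bar_open a) (bar_basis a).
rewrite -(scalerK ka (bar_sec a t)) rpredZ //.
move: sum0; rewrite (bigD1_seq a) //= => /eqP; rewrite addr_eq0 => /eqP->.
rewrite rpredN big_seq_cond rpred_sum // => b /andP[br nba].
rewrite rpredZ //; apply: in_span_gen.
have [[Ubt _] _] := rP b br.
case: (pselect (bar_dom b `<=` bar_dom a)) => [ba|/existsNP[s /not_implyP[bs nas]]].
  have eab : bar_dom b = bar_dom a by apply/seteqP; split=> //; exact: amin.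
  right; exists (bar_sec b) => //; split; first by rewrite -eab; exact: bar_basis.
  by move=> /(bar_eq eab) eba; rewrite eba eqxx in nba.
left; exists s => //; exists (bar_sec b s); apply: bar_section => //.
by case: (leP s t) => // /ltW/((bar_open a).1 t s Ut).
Qed.

(** Stated for a subspace P containing the bars. Were P proper, take v outside P in
    an image im(M s1 -> M t) that is minimal among the images meeting the
    complement of P. Its birth cut U contains s1. Subtracting from v an element of
    P leaves a vector outside P that comes from some s outside U, so s < s1; by
    minimality the images from s and s1 agree, and v comes from s, hence s is
    in U. *)
Lemma bars_span t (P : set (M t)) : subspace P ->
  (forall a, alive a t -> P (bar_sec a t)) -> forall v, P v.
Proof.
move=> Psub Pbar v0; apply: contrapT => nPv0; have [P0 PD] := Psub.
have nP0 v : ~ P v -> v != 0 by move=> nPv; apply: contra_notN nPv => /eqP->.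
have [s0 s0t v0s0] := lower_semicontinuous_im Mlsc (nP0 _ nPv0).
have [||s1 [s10 [v vs1 nPv]] s1min] := @qtame_minimal _ _ _ M s0 t T
    [set s | (s <= s0)%O /\ exists2 v, im M s t v & ~ P v] (fun s => im M s t)
    Mq s0t (fun s => im_subspace M s t).
- by move=> s [ss0 _]; apply: im_mono => //; exact: ltW.
- by exists s0; split=> //; exists v0.
have s1t := le_trans s10 (ltW s0t).
(* The implication makes every parameter above t a member of U. *)
pose U := [set s | (s <= t)%O -> im M s t v].
have Uup s s' : U s -> (s <= s')%O -> U s'.
  by move=> Us ss' s't; apply: im_mono (Us _) => //; exact: le_trans s't.
have Uopen : open_upset U.
  split=> // r Ur; case: (leP r t) => [rt|tr_]; last first.
    by exists t => // _; exists v; rewrite tr_id.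
  have [w wE] := Ur rt.
  have w0 : w != 0 by apply: contraNneq (nP0 _ nPv) => w0; rewrite -wE w0 linear0.
  have [s sr [u uE]] := lower_semicontinuous_im Mlsc w0.
  by exists s => // _; exists u; rewrite -(tr_comp _ (ltW sr) rt) uE.
have Ut : U t by move=> _; exists v; rewrite tr_id.
have vW : v \in born_span M U (S U) t by apply: Sspan => // r Ur; exact: Ur.
pose E := [set u : M t | u != 0 -> exists2 s, ~ U s & im M s t u].
have nUt s : ~ U s -> (s <= t)%O by case: (leP s t) => // /ltW/(Uup _ _ Ut).
have [E0 ED] : subspace E by exact: (@im_bigcup_subspace _ _ _ M (~` U) t nUt).
have vdec u : u \in born_span M U (S U) t -> exists2 u', P u' & E (u - u').
  move: u; apply: in_span_ind.
    split=> [|k u w [u' Pu' Eu'] [w' Pw' Ew']]; first by exists 0; rewrite ?subr0.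
    exists (k *: u' + w'); first exact: PD.
    by rewrite opprD addrACA -scalerBr; exact: ED.
  move=> u [[s nUs us]|[y Sy <-]].
    by exists 0 => //; rewrite subr0 => _; exists s.
  exists (y t); last by rewrite subrr.
  have [->//|yt] := eqVneq (y t) 0.
  pose a : bar := exist _ (U, y) (conj Uopen Sy).
  exact: (Pbar a).
have [u Pu Evu] := vdec v vW.
have nPvu : ~ P (v - u).
  by move=> Pvu; apply: nPv; rewrite -(subrK u v) -(scale1r (v - u)); exact: PD.
have [s nUs vus] := Evu (nP0 _ nPvu).
have ss1 : (s <= s1)%O.
  by case: (leP s s1) => // /ltW s1s; case: nUs => st; exact: im_mono vs1.
apply: nUs => st; apply: (s1min s) vs1; last exact: im_mono.
by split; [exact: le_trans s10 | exists (v - u)].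
Qed.

Definition bar_sum t :
    {linear pm_dsum (fun a : bar => itv_mod F (bar_itv a)) t -> M t} :=
  dsum_out (V := fun a : bar => itv_obj F (bar_itv a) t)
    (fun a => itv_out `[< alive a t >] (bar_sec a t)).

Lemma bar_sumE t (y : dsum (fun a : bar => itv_obj F (bar_itv a) t))
    (B : set bar) : finite_set B -> [set a | y a != 0] `<=` B ->
  bar_sum t y = \sum_(a \in B) itv_out `[< alive a t >] (bar_sec a t) (y a).
Proof. exact: dsum_outE. Qed.

Lemma bar_sum_nat s t (st : (s <= t)%O)
    (y : pm_dsum (fun a : bar => itv_mod F (bar_itv a)) s) :
  bar_sum t (pm_map (pm_dsum (fun a : bar => itv_mod F (bar_itv a))) st y)
  = pm_map M st (bar_sum s y).
Proof.
have finB := dsum_fin y.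
rewrite (@bar_sumE s y _ finB) // (@bar_sumE t _ _ finB); last first.
  by move=> a /=; apply: contra_neq => ->; rewrite linear0.
rewrite !fsbig_finite; try exact: dsum_fin.
rewrite linear_sum; apply: eq_bigr => a _.
apply: itv_out_map => /asboolP[Us xs].
rewrite -(trE st) (bar_section Us st); case: asboolP => // nat_.
apply/eqP; apply: contra_notT nat_ => xt; split=> //.
exact: (bar_open a).1 Us st.
Qed.

Lemma bar_sum_inj t : injective (bar_sum t).
Proof.
suff ker0 y : bar_sum t y = 0 -> y = 0 by exact: raddf_inj ker0.
rewrite (@bar_sumE t y _ (dsum_fin y)) //.
rewrite fsbig_finite; last exact: dsum_fin.
have [k kP] := choice (fun a => itv_outE (bar_sec a t) (y a)).
rewrite (eq_bigr (fun a => k a *: bar_sec a t)); last first.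
  by move=> a _; have [] := kP a.
move=> /bars_free; rewrite finmap.fset_uniq => /(_ isT) y0.
apply: dsumP => a; apply/eqP; apply: contraT => ya.
have memE b : (b \in finmap.enum_fset (fset_set [set a | y a != 0])) = (y b != 0).
  by rewrite [LHS](in_fset_set (dsum_fin y)); apply/idP/idP; rewrite in_setE.
suff : a \in finmap.enum_fset (fset_set [set a | y a != 0]).
  by rewrite y0 // => b; rewrite memE => yb; have [_ /(_ yb)[/asboolP]] := kP b.
by rewrite memE.
Qed.

Lemma bar_sum_onto t v : exists y, bar_sum t y = v.
Proof.
apply: (@bars_span t [set v | exists y, bar_sum t y = v]) => [|a at_].
  split=> [|k _ _ [y <-] [z <-]]; first by exists 0; rewrite linear0.
  by exists (k *: y + z); rewrite linearP.
have [c cE] : exists c, itv_out `[< alive a t >] (bar_sec a t) c = bar_sec a t.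
  by apply: itv_out_onto; exact/asboolP.
exists (dsum_in (fun a : bar => itv_obj F (bar_itv a) t) c).
by rewrite /bar_sum /= dsum_out_in.
Qed.

Lemma section_bases_barcode : has_barcode M.
Proof.
exists bar, bar_itv; apply: (@pm_iso_bij _ _ _ _ _ (PMHom bar_sum_nat)) => t.
  exact: bar_sum_inj.
exact: bar_sum_onto.
Qed.

End Barcode.

Theorem theorem1p2 (F : fieldType) (d : Order.disp_t) (T : orderType d)
  (T_dense : dense_order T)
  (T_coinitial : forall I : order_interval T, countably_coinitial I)
  (M : persmod F T)
  (M_qtame : qtame M)
  (M_lsc : lower_semicontinuous M) :
  has_barcode M.
Proof.
have /choice[S SP] (U : set T) : exists S : set (forall t, M t), open_upset U ->
    independent_sections U S /\
    forall t v, U t -> upper_im M U t v -> v \in born_span M U S t.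
  case: (pselect (open_upset U)) => [Uopen|]; last by exists set0.
  by have [S SP] := exists_section_basis M_qtame T_coinitial Uopen; exists S.
apply: (@section_bases_barcode _ _ _ M M_qtame M_lsc S) => U Uopen.
  by have [] := SP U Uopen.
by have [_] := SP U Uopen.
Qed.
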